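(* Let $G$ be a (profinite) self-similar group and $\mathcal P$ a property of its closed subgroups. Then $\mathcal P$ is self-similar if the collection of $\mathcal P$-subgroups is closed under the following two operations: (1) Given a $\mathcal P$-subgroup $H$ and a vertex $v$, the compositum $HH^v$ is a $\mathcal P$-subgroup. (2) If $(H_i)_{i\in\mathcal I}$ is an ascending chain of $\mathcal P$-subgroups, then $\overline{\bigcup_i H_i}$ is also a $\mathcal P$-subgroup. If $\mathcal P$ implies open (every $\mathcal P$-subgroup is open in $G$), then the second condition is unnecessary.
   Context: Let $T$ be the infinite $d$-regular rooted tree, with path data: a labeling of the vertices at level one by $0,\dots,d-1$ and, for each such vertex $i$, a rooted tree isomorphism $\lambda_i:T_i\to T$, where $T_v$ denotes the subtree over a vertex $v$. For each vertex $v$ there is a unique composition $\lambda_v:T_v\to T$ of the $\lambda_i$'s taking $v$ to the root. For a subgroup $H\le\mathrm{Aut}\,T$, $H_v$ is the stabilizer of $v$ in $H$, $\pi_v(h)=\lambda_v\circ h|_{T_v}\circ\lambda_v^{-1}$ for $h\in H_v$, and $H^v=\pi_v(H_v)$. A (profinite) self-similar group is a closed subgroup $G\le\mathrm{Aut}\,T$ with $G^v\subseteq G$ for every vertex $v$; a subgroup is self-similar if it satisfies the same condition. The self-similar closure of a closed subgroup $H\le G$ is the smallest closed self-similar subgroup of $G$ containing $H$. A property $\mathcal P$ of closed subgroups of $G$ is self-similar if whenever $H$ satisfies $\mathcal P$, so does the self-similar closure of $H$; a $\mathcal P$-subgroup is a closed subgroup satisfying $\mathcal P$. The compositum $HH'$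 of two closed subgroups is the closed subgroup they generate; the bar denotes topological closure. *)

(* Defs.v *)
From HB Require Import structures.
#[warnings="-notation-overridden,-notation-incompatible-prefix"]
From mathcomp Require Import all_boot all_order all_classical topology.

Set Implicit Arguments.
Unset Strict Implicit.
Unset Printing Implicit Defensive.

Local Open Scope classical_set_scope.

(** Model of the d-regular rooted tree: vertices are words, the root is the
    empty word, and the children of [w] are the words [rcons w x]. *)
Notation vertex d := (seq 'I_d).

Definition child d (w w' : vertex d) : bool := [exists x, w' == rcons w x].

Definition subtree d (v : vertex d) : set (vertex d) := [set w | prefix v w].

(** [f] restricts to an isomorphism of rooted trees from [subtree u] onto
    [subtree v]; its values outside [subtree u] are irrelevant. *)
Definition tree_iso d (u v : vertex d) (f : vertex d -> vertex d) : Prop :=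
  [/\ set_bij (subtree u) (subtree v) f,
      f u = v &
      {in subtree u &, {mono f : w w' / child w w'}}].

Lemma tree_iso_id d (v : vertex d) : tree_iso v v id.
Proof. by split=> //; split=> // w vw; exists w. Qed.

Lemma tree_iso_comp d (u v w : vertex d) f g :
  tree_iso u v f -> tree_iso v w g -> tree_iso u w (g \o f).
Proof.
case=> fb fu fm [gb gv gm]; split; first exact: set_bij_comp fb gb.
  by rewrite /= fu.
case: fb => fF _ _ x y; rewrite !inE => ux uy /=.
by rewrite gm ?fm ?inE//; apply: fF.
Qed.

Lemma tree_iso_pinv d (u v : vertex d) (dflt : vertex d -> vertex d) f :
  tree_iso u v f -> tree_iso v u ('pinv_dflt (subtree u) f).
Proof.
case=> fb fu fm; have [fF fI fS] := fb.
have pb := bijpinv_bij dflt fb; have [pF _ _] := pb.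
have pK w : subtree v w -> f ('pinv_dflt (subtree u) f w) = w.
  by move=> vw; rewrite pinvK// inE; exact: fS.
split=> //; first by rewrite -fu pinvKV// inE /subtree/= prefix_refl.
move=> x y; rewrite !inE => vx vy.
by rewrite -fm ?inE ?pK//; apply: pF.
Qed.

Lemma childP d (w w' : vertex d) :
  reflect (exists x, w' = rcons w x) (child w w').
Proof. by apply: (iffP existsP) => -[x /eqP]; exists x => //; exact/eqP. Qed.

Lemma tree_iso_cat d (u v : vertex d) f s : tree_iso u v f ->
  exists2 t, size t = size s & f (u ++ s) = v ++ t.
Proof.
case=> _ fu fm; elim/last_ind: s => [|s x [t ts ft]].
  by exists [::]; rewrite ?cats0.
have : child (f (u ++ s)) (f (u ++ rcons s x)).
  rewrite fm ?inE /subtree/= ?prefix_prefix//.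
  by apply/childP; exists x; rewrite rcons_cat.
move=> /childP[y ->]; exists (rcons t y); first by rewrite !size_rcons ts.
by rewrite ft rcons_cat.
Qed.

Lemma tree_iso_subtree d (u v w : vertex d) f :
  tree_iso u v f -> subtree u w -> tree_iso w (f w) f.
Proof.
move=> fiso uw; have [[fF fI fS] fu fm] := fiso.
have sub a : subtree w a -> subtree u a by apply: prefix_trans.
have fm' : {in subtree w &, {mono f : a b / child a b}}.
  by move=> a b; rewrite !inE => wa wb; apply: fm; rewrite inE; exact: sub.
have fw s : exists2 t, size t = size s & f (w ++ s) = f w ++ t.
  elim/last_ind: s => [|s x [t ts ft]]; first by exists [::]; rewrite ?cats0.
  have : child (f (w ++ s)) (f (w ++ rcons s x)).
    rewrite fm' ?inE /subtree/= ?prefix_prefix//.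
    by apply/childP; exists x; rewrite rcons_cat.
  move=> /childP[y ->]; exists (rcons t y); first by rewrite !size_rcons ts.
  by rewrite ft rcons_cat.
split=> //; split.
- move=> _ /prefixP[s ->]; have [t _ ->] := fw s.
  exact: prefix_prefix.
- by move=> a b; rewrite !inE => wa wb; apply: fI; rewrite inE; exact: sub.
- move=> _ /prefixP[t ->].
  elim/last_ind: t => [|t y [a wa at']].
    by exists w; rewrite ?cats0 //; exact: prefix_refl.
  have [b ub fb] : (f @` subtree u) (f w ++ rcons t y).
    apply: fS; apply: prefix_trans (prefix_prefix _ _).
    exact: fF.
  exists b => //; have : child (f a) (f b).
    by apply/childP; exists y; rewrite at' fb rcons_cat.
  rewrite fm ?inE//; last exact: sub.
  by move=> /childP[x ->]; exact: prefix_trans wa (prefix_rcons _ _).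
Qed.

(** Aut T: since T is [subtree [::]], these are the rooted automorphisms. *)
Record aut d := Aut {
  aut_fun :> vertex d -> vertex d;
  aut_iso : `[< tree_iso [::] [::] aut_fun >] }.

HB.instance Definition _ d := [isSub for @aut_fun d].
HB.instance Definition _ d := [Choice of aut d by <:].

Section AutGroup.
Variable d : nat.
Implicit Types g h : aut d.

Lemma autP g : tree_iso [::] [::] g. Proof. exact/asboolP/aut_iso. Qed.

Lemma aut_eqP g h : g =1 h <-> g = h.
Proof. by split=> [/funext gh|->//]; exact: val_inj. Qed.

Definition aut_one : aut d := Aut (introT (asboolP _) (tree_iso_id [::])).

(** Composition of functions: [(g * h) w = g (h w)]. *)
Definition aut_mul g h : aut d :=
  Aut (introT (asboolP _) (tree_iso_comp (autP h) (autP g))).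

Definition aut_inv g : aut d :=
  Aut (introT (asboolP _) (tree_iso_pinv id (autP g))).

Lemma aut_mulA : associative aut_mul. Proof. by move=> f g h; exact/aut_eqP. Qed.
Lemma aut_mul1 : left_id aut_one aut_mul. Proof. by move=> g; exact/aut_eqP. Qed.
Lemma aut_mulr1 : right_id aut_one aut_mul. Proof. by move=> g; exact/aut_eqP. Qed.

Lemma aut_mulV : left_inverse aut_one aut_inv aut_mul.
Proof.
move=> g; apply/aut_eqP => w /=; have [[_ gI _] _ _] := autP g.
by rewrite (pinvKV _ gI) //; exact/mem_set/prefix0s.
Qed.

Lemma aut_mulrV : right_inverse aut_one aut_inv aut_mul.
Proof.
move=> g; apply/aut_eqP => w /=; have [[_ _ gS] _ _] := autP g.
by rewrite pinvK //; apply/mem_set/gS/prefix0s.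
Qed.

HB.instance Definition _ :=
  isGroup.Build (aut d) aut_mulA aut_mul1 aut_mulr1 aut_mulV aut_mulrV.

(** Profinite topology of Aut T: a neighbourhood base of [g] is given by the
    cosets of the pointwise stabilizers of the levels up to [n]. *)
Definition level_ball g (n : nat) : set (aut d) :=
  [set h | forall w, size w <= n -> h w = g w].

Definition aut_nbhs g : set_system (aut d) :=
  filter_from setT (level_ball g).

HB.instance Definition _ := hasNbhs.Build (aut d) aut_nbhs.

Lemma aut_nbhs_filter g : ProperFilter (nbhs g).
Proof.
apply: filter_from_proper; last by move=> n _; exists g.
apply: filter_from_filter; first by exists 0.
move=> m n _ _; exists (maxn m n) => // h hg.
by split=> w wn; apply: hg; rewrite leq_max wn ?orbT.
Qed.

Lemma aut_nbhs_singleton g (A : set (aut d)) : nbhs g A -> A g.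
Proof. by case=> n _; apply. Qed.

Lemma aut_nbhs_nbhs g (A : set (aut d)) : nbhs g A -> nbhs g (nbhs^~ A).
Proof.
case=> n _ gA; exists n => // h hg; exists n => // k kh.
by apply: gA => w wn; rewrite kh// hg.
Qed.

HB.instance Definition _ := Nbhs_isNbhsTopological.Build (aut d)
  aut_nbhs_filter aut_nbhs_singleton aut_nbhs_nbhs.

End AutGroup.

(** [label x] is the label of the level-one vertex [[:: x]], and [lam i] is the
    isomorphism from the subtree over the vertex labelled [i] onto T. *)
Record path_data d := PathData {
  label : 'I_d -> 'I_d;
  label_bij : bijective label;
  lam : 'I_d -> vertex d -> vertex d;
  lam_iso : forall x, tree_iso [:: x] [::] (lam (label x)) }.

(** The isomorphism from [subtree v] onto T attached to [v]: apply the [lam i]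
    of the level-one vertex above [v], which moves [v] one level up, and
    iterate as many times as the level of [v]. *)
Fixpoint lambda_rec d (L : path_data d) (n : nat) (v : vertex d) :
    vertex d -> vertex d :=
  match n, v with
  | n'.+1, x :: _ =>
      let l := lam L (label L x) in lambda_rec L n' (l v) \o l
  | _, _ => id
  end.

Definition lambda d (L : path_data d) (v : vertex d) := lambda_rec L (size v) v.

Lemma lambda_iso d (L : path_data d) v : tree_iso v [::] (lambda L v).
Proof.
suff rec n w : size w = n -> tree_iso w [::] (lambda_rec L n w) by exact: rec.
elim: n w => [|n IH] [|x v'] //=; first by move=> _; exact: tree_iso_id.
move=> [vn].
have [t tv lv] := tree_iso_cat v' (lam_iso L x).
apply: tree_iso_comp (tree_iso_subtree (lam_iso L x) _) _.
  exact: prefix_prefix [:: x] v'.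
by apply: IH; rewrite -cat1s lv tv.
Qed.

Section SelfSimilar.
Variables (d : nat) (L : path_data d).
Implicit Types (v : vertex d) (G H K : set (aut d)) (P : set (aut d) -> Prop).

Definition stab H v : set (aut d) := [set h | H h /\ h v = v].

(** lambda_v o h o lambda_v^-1, meaningful when [h v = v]. *)
Definition proj v (h : aut d) : vertex d -> vertex d :=
  lambda L v \o h \o 'pinv_id (subtree v) (lambda L v).

Lemma proj_aut v (h : aut d) : h v = v -> exists g : aut d, g =1 proj v h.
Proof.
move=> hv; have li := lambda_iso L v.
have hi : tree_iso v v h.
  by rewrite -{2}hv; apply: tree_iso_subtree (autP h) (prefix0s v).
by exists (Aut (introT (asboolP _)
  (tree_iso_comp (tree_iso_comp (tree_iso_pinv id li) hi) li))).
Qed.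

(** H^v = pi_v(H_v) *)
Definition vgroup H v : set (aut d) :=
  [set g : aut d | exists2 h, stab H v h & g =1 proj v h].

Definition closed_subgroup H : Prop := closed H /\ group_closed (mem H).

Definition self_similar H : Prop := forall v, vgroup H v `<=` H.

Definition self_similar_group G : Prop := closed_subgroup G /\ self_similar G.

Definition self_similar_closure G H : set (aut d) :=
  smallest [set K | [/\ closed_subgroup K, K `<=` G & self_similar K]] H.

Definition compositum H K : set (aut d) :=
  smallest closed_subgroup (H `|` K).

Definition P_subgroup G P H : Prop :=
  [/\ closed_subgroup H, H `<=` G & P H].

Definition self_similar_property G P : Prop :=
  forall H, P_subgroup G P H -> P (self_similar_closure G H).

Definition closed_under_vcompositum G P : Prop :=
  forall H v, P_subgroup G P H -> P_subgroup G P (compositum H (vgroup H v)).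

(** The index set is an arbitrary nonempty totally ordered set. *)
Definition closed_under_chains G P : Prop :=
  forall (disp : Order.disp_t) (I : orderType disp) (i0 : I)
         (H : I -> set (aut d)),
    (forall i j, (i <= j)%O -> H i `<=` H j) ->
    (forall i, P_subgroup G P (H i)) ->
    P_subgroup G P (closure (\bigcup_i H i)).

Definition open_in G H : Prop := exists2 U, open U & H = G `&` U.

End SelfSimilar.

(* Main.v *)
(** Among the P-subgroups lying between [H] and its self-similar closure [C]
    choose a maximal one, [K].  Since [K^v] is contained in [C^v], hence in [C],
    the compositum of [K] and [K^v] is again such a subgroup, so [K^v] is
    contained in [K] for every [v]: thus [K] is self-similar and equals [C].
    A maximal element exists by Zorn's lemma if P is closed under chains.  If P
    implies open, then [H] contains the stabilizer in [G] of some finite level,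
    so the subgroups of [G] above [H] are determined by their action on a finite
    subtree, and finiteness gives a maximal one. *)
From HB Require Import structures.
Require Import Defs.
From mathcomp Require Import all_boot all_order all_classical topology.

Set Implicit Arguments.
Unset Strict Implicit.
Unset Printing Implicit Defensive.

Local Open Scope classical_set_scope.

Lemma closed_subgroup1 d (H : set (aut d)) : closed_subgroup H -> H 1%g.
Proof. by case=> _ [/set_mem]. Qed.

Lemma closed_subgroupM d (H : set (aut d)) g h :
  closed_subgroup H -> H g -> H h -> H (g * h)%g.
Proof.
by move=> [_ Hg] Hg' Hh; apply/set_mem/(group_closedM Hg); exact/mem_set.
Qed.

Lemma closed_subgroup_bigcap d (F : set (set (aut d))) :
  F `<=` @closed_subgroup d -> closed_subgroup (\bigcap_(K in F) K).
Proof.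
move=> Fgr; split; first by apply: closed_bigI => K /Fgr[].
split; first by apply/mem_set => K /Fgr /closed_subgroup1.
move=> g h /set_mem Hg /set_mem Hh; apply/mem_set => K FK.
have [_ [_ Kdiv]] := Fgr K FK.
by apply/set_mem/Kdiv; apply/mem_set; [apply: Hg | apply: Hh].
Qed.

Lemma vgroupS d (L : path_data d) (H K : set (aut d)) v :
  H `<=` K -> vgroup L H v `<=` vgroup L K v.
Proof. by move=> HK g [h [Hh hv] gh]; exists h => //; split=> //; exact: HK. Qed.

(** Turns agreement up to level [n] into membership in the level stabilizer, the form in which
    openness of a subgroup is applied. *)
Lemma level_ball_mulV d (g h : aut d) n :
  level_ball g n h -> level_ball 1%g n (g^-1 * h)%g.
Proof.
move=> hg w wn; have -> : (g^-1 * h)%g w = (g^-1)%g (h w) by [].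
rewrite hg //; have -> : (g^-1)%g (g w) = (g^-1 * g)%g w by [].
by rewrite mulVg.
Qed.

Section SelfSimilarClosure.
Variables (d : nat) (L : path_data d) (G : set (aut d)).

Lemma self_similar_closure_closed_subgroup H :
  closed_subgroup (self_similar_closure L G H).
Proof. by apply: closed_subgroup_bigcap => K [[]]. Qed.

(** Since [vgroup] is monotone, a vertex group of the intersection lies in that of each member [K]
    of the family, hence in [K]. *)
Lemma self_similar_closure_self_similar H :
  self_similar L (self_similar_closure L G H).
Proof.
move=> v g Cg K [[cK KG sK] HK]; apply: (sK v); apply: vgroupS Cg.
by apply: smallest_sub.
Qed.

Variable P : set (aut d) -> Prop.

Definition intermediate_P_subgroup H : set (set (aut d)) :=
  [set K | [/\ P_subgroup G P K, H `<=` K & K `<=` self_similar_closure L G H]].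

Lemma intermediate_P_subgroup_refl H :
  P_subgroup G P H -> intermediate_P_subgroup H H.
Proof. by move=> PH; split=> //; exact: sub_gen_smallest. Qed.

Lemma maximal_intermediate_P H K :
    closed_under_vcompositum L G P -> intermediate_P_subgroup H K ->
    (forall K', intermediate_P_subgroup H K' -> K `<=` K' -> K' `<=` K) ->
  P (self_similar_closure L G H).
Proof.
move=> Pcomp [PK HK KC] Kmax; have [cK KG KP] := PK.
suff -> : self_similar_closure L G H = K by [].
apply/seteqP; split=> //; apply: smallest_sub => //; split=> // v.
set K' := compositum K (vgroup L K v).
have KK' : K `<=` K' by move=> h Kh; apply: sub_gen_smallest; left.
have K'C : K' `<=` self_similar_closure L G H.
  apply: smallest_sub; first exact: self_similar_closure_closed_subgroup.
  rewrite subUset; split=> //; apply: subset_trans (vgroupS KC) _.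
  exact: self_similar_closure_self_similar.
apply: subset_trans (Kmax K' _ KK').
  by move=> h Kvh; apply: sub_gen_smallest; right.
by split=> //; [exact: Pcomp | exact: subset_trans KK'].
Qed.

(** Passes from chains indexed by an [orderType] to chains given as sets: [F] indexes itself,
    ordered by inclusion. *)
Lemma closed_under_chains_set (F : set (set (aut d))) :
    closed_under_chains G P -> F !=set0 -> total_on F subset ->
    F `<=` P_subgroup G P ->
  P_subgroup G P (closure (\bigcup_(K in F) K)).
Proof.
move=> Pchain [K0 FK0] Ftot FP.
(* Boolean membership makes [S] a subtype with injective [val], which gives antisymmetry of
   inclusion on [S]. *)
pose S := {K : set (aut d) | K \in F}.
pose le (A B : S) := `[< val A `<=` val B >].
have le_refl : reflexive le by move=> A; apply/asboolP.
have le_anti : antisymmetric le.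
  move=> A B /andP[/asboolP AB /asboolP BA].
  by apply: val_inj; apply/seteqP.
have le_trans : transitive le.
  by move=> B A C /asboolP AB /asboolP BC; apply/asboolP; exact: subset_trans BC.
have le_total : total le.
  move=> [A A_F] [B B_F]; apply/orP.
  by case: (Ftot A B (set_mem A_F) (set_mem B_F)) => AB;
    [left | right]; apply/asboolP.
pose Sle := Order.Le_isPOrder.Build Order.default_display S
  le_refl le_anti le_trans.
pose Spo : porderType _ := HB.pack S Sle.
pose Sto := Order.POrder_isTotal.Build _ Spo le_total.
pose I : orderType _ := HB.pack S Sle Sto.
have := @Pchain _ I (exist _ K0 (mem_set FK0)) (fun A => sval A).
have -> : \bigcup_(A : I) sval A = \bigcup_(K in F) K.
  apply/seteqP; split=> g.
    by move=> [[A FA] _ Ag]; exists A => //; exact: set_mem.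
  by move=> [A FA Ag]; exists (exist _ A (mem_set FA)).
apply.
- by move=> A B /asboolP.
- by move=> [A FA]; apply: FP; exact: set_mem.
Qed.

Lemma chains_maximal_intermediate H :
    closed_under_chains G P -> P_subgroup G P H ->
  exists2 K, intermediate_P_subgroup H K &
    forall K', intermediate_P_subgroup H K' -> K `<=` K' -> K' `<=` K.
Proof.
move=> Pchain PH; pose M := {K | intermediate_P_subgroup H K}.
pose R (A B : M) := `[< sval A `<=` sval B >].
pose H0 : M := exist _ H (intermediate_P_subgroup_refl PH).
have [|||[K MK] Kmax] := @ZL_preorder M H0 R.
- by move=> A; apply/asboolP.
- by move=> A B C /asboolP BA /asboolP AC; apply/asboolP; exact: (subset_trans BA).
(* The chain condition only covers nonempty chains; the empty one is bounded by [H] itself. *)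
- move=> F Ftot; have [->|/set0P[A0 FA0]] := eqVneq F set0; first by exists H0.
  pose F' := [set sval A | A in F].
  have F'M : F' `<=` intermediate_P_subgroup H by move=> _ [[A MA] _ <-].
  have PU : P_subgroup G P (closure (\bigcup_(A in F') A)).
    apply: closed_under_chains_set => //.
    + by exists (sval A0), A0.
    + move=> _ _ [A FA <-] [B FB <-].
      by have [/asboolP|/asboolP] := Ftot A B FA FB; [left | right].
    + by move=> A /F'M[].
  have subU A : F' A -> A `<=` closure (\bigcup_(A in F') A).
    by move=> F'A; apply: subset_trans (@subset_closure _ _); exact: bigcup_sup.
  have MU : intermediate_P_subgroup H (closure (\bigcup_(A in F') A)).
    split=> //.
    + have F'A0 : F' (sval A0) by exists A0.
      by apply: subset_trans (subU _ F'A0); have [] := F'M _ F'A0.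
    (* The self-similar closure is closed, so it contains the closure of any union of its
       subsets. *)
    + have [Ccl _] := self_similar_closure_closed_subgroup H.
      move/closure_id: Ccl => ->; apply: closureS.
      by apply: bigcup_sub => A /F'M[].
  exists (exist _ _ MU) => A FA; apply/asboolP; apply: subU.
  by exists A.
- exists K => // K' MK' KK'; apply/asboolP.
  by apply: (Kmax (exist _ K' MK')); apply/asboolP.
Qed.

(* [insub_bseq] never takes its default value here: [g] preserves sizes. *)
Definition level_action n (g : aut d) :
    {ffun n.-bseq 'I_d -> n.-bseq 'I_d} :=
  [ffun w : n.-bseq 'I_d => insub_bseq n (g w)].

Lemma level_action_eq n (g h : aut d) :
  level_action n g = level_action n h -> level_ball g n h.
Proof.
have sz (f : aut d) w : size (f w) = size w.
  by have [t tw] := tree_iso_cat w (autP f); rewrite /= => ->.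
move=> /ffunP gh w wn; have := gh (Bseq wn); rewrite !ffunE /= => /(congr1 val).
by rewrite /insub_bseq !val_insubd !sz wn.
Qed.

(** Maximality under inclusion is obtained by maximizing the number of level actions realized by
    [K], an integer bounded because there are finitely many words of length at most [n]. *)
Lemma open_maximal_intermediate H :
    open_in G H -> P_subgroup G P H ->
  exists2 K, intermediate_P_subgroup H K &
    forall K', intermediate_P_subgroup H K' -> K `<=` K' -> K' `<=` K.
Proof.
move=> [U Uop HU] PH; have [cH HG _] := PH.
(* This [n] is such that every element of [G] acting trivially up to level [n] lies in [H]. *)
have [n _ nU] : nbhs (1%g : aut d) U.
  apply: open_nbhs_nbhs; split=> //.
  by have := closed_subgroup1 cH; rewrite HU => -[].
pose im (K : set (aut d)) :=
  [set f | `[< exists2 g, K g & level_action n g = f >]]%SET.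
have imS K K' : K `<=` K' -> im K \subset im K'.
  move=> KK'; apply/fintype.subsetP => f; rewrite !inE => -[g Kg gf].
  by exists g; [exact: KK' |].
pose Q m := `[< exists2 K, intermediate_P_subgroup H K & #|im K| = m >].
have exQ : exists m, Q m.
  by exists #|im H|; apply/asboolP; exists H => //;
    exact: intermediate_P_subgroup_refl.
have ubQ m : Q m -> (m <= #|{ffun n.-bseq 'I_d -> n.-bseq 'I_d}|)%N.
  by move=> /asboolP[K _ <-]; exact: max_card.
have [_ /asboolP[K MK <-] Kmax] := ex_maxnP exQ ubQ.
exists K => // K' MK' KK' g K'g.
(* [im K] is contained in [im K'] and already has the largest possible cardinal. *)
have imK : im K = im K'.
  apply/eqP; rewrite eqEcard imS //=; apply: Kmax; apply/asboolP.
  by exists K'.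
have : level_action n g \in im K.
  by rewrite imK !inE; exists g.
rewrite !inE => -[h Kh /level_action_eq hg].
have [[cK KG _] HK _] := MK; have [[cK' K'G _] _ _] := MK'.
(* The quotient lies in [K'], hence in [G], and fixes all words up to level [n]; so it lies in [H],
   hence in [K]. *)
have Kgh : K (h^-1 * g)%g.
  apply: HK; rewrite HU; split; last exact/nU/level_ball_mulV.
  apply: K'G; apply: closed_subgroupM => //; apply/set_mem.
  by apply: group_closedV (mem_set (KK' _ Kh)); case: cK'.
by rewrite -[g](mulVKg h); exact: closed_subgroupM.
Qed.

End SelfSimilarClosure.

Theorem proposition21 (d : nat) (d_gt0 : (0 < d)%N) (L : path_data d)
    (G : set (aut d)) (ssG : self_similar_group L G)
    (P : set (aut d) -> Prop) :
  closed_under_vcompositum L G P ->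
  (closed_under_chains G P -> self_similar_property L G P) /\
  ((forall H, P_subgroup G P H -> open_in G H) -> self_similar_property L G P).
Proof.
move=> Pcomp; split=> [Pchain|Popen] H PH.
- have [K MK Kmax] := chains_maximal_intermediate L Pchain PH.
  exact: maximal_intermediate_P MK Kmax.
- have [K MK Kmax] := open_maximal_intermediate L (Popen H PH) PH.
  exact: maximal_intermediate_P MK Kmax.
Qed.
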